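(* Let $d,c,n$ be positive integers, $p=2n+d+c$, $X\in\mathbb{R}^{n\times d}$, $Y\in\mathbb{R}^{n\times c}$, $\gamma\ge 0$. Consider the problem (CP-NN) $$\min_{\Lambda \in \mathbb{R}^{p\times p}} \big\| P_\alpha \Lambda P_v^\top - Y \big\|_F^2 + \frac{\gamma}{2}\big(\mathrm{trace}(P_u\Lambda P_u^\top) + \mathrm{trace}(P_v \Lambda P_v^\top)\big)$$ subject to $$\mathrm{trace}(P_\alpha\Lambda P_\beta^\top) + \mathrm{trace}(M\Lambda M^\top) = 0,\qquad \Lambda \in \mathcal{PSD}_p,\qquad P_{\alpha\beta}\Lambda P_{\alpha\beta}^\top \in \mathcal{CP}_{2n},$$ and the semidefinite program (SDP-NN) $$\min_{\Lambda \in \mathbb{R}^{p\times p}} \big\| P_\alpha \Lambda P_v^\top - Y \big\|_F^2 + \frac{\gamma}{2}\big(\mathrm{trace}(P_u\Lambda P_u^\top) + \mathrm{trace}(P_v \Lambda P_v^\top)\big)$$ subject to $$\mathrm{trace}(P_\alpha\Lambda P_\beta^\top) + \mathrm{trace}(M\Lambda M^\top) = 0,\qquad \Lambda \in \mathcal{PSD}_p,\qquad P_{\alpha\beta}\Lambda P_{\alpha\beta}^\top \in \mathcal{N}_{2n}.$$ Then (SDP-NN) is a relaxation of (CP-NN), i.e. it has the same objective function and every feasible point of (CP-NN) is feasible for (SDP-NN). Moreover, (SDP-NN) is exactly the problem obtained from (CP-NN) by replacing the constraint $P_{\alpha\beta}\Lambda P_{\alpha\beta}^\top \in \mathcal{CP}_{2n}$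 by $P_{\alpha\beta}\Lambda P_{\alpha\beta}^\top \in \mathcal{DNN}_{2n}$, since the condition $P_{\alpha\beta}\Lambda P_{\alpha\beta}^\top\in\mathcal{PSD}_{2n}$ holds for every $\Lambda\in\mathcal{PSD}_p$.
   Context: $\mathcal{PSD}_k := \mathrm{conv}\{ww^\top : w\in\mathbb{R}^k\}$ is the cone of symmetric positive semidefinite $k\times k$ matrices; $\mathcal{CP}_k := \mathrm{conv}\{ww^\top : w \in \mathbb{R}^k_+\}$ is the completely positive cone, where $\mathbb{R}^k_+$ denotes the entrywise non-negative vectors; $\mathcal{N}_k$ is the cone of entrywise non-negative $k\times k$ matrices; $\mathcal{DNN}_k := \mathcal{PSD}_k\cap\mathcal{N}_k$ is the doubly non-negative cone. The coordinates of $\mathbb{R}^p$, $p = 2n+d+c$, are split into consecutive blocks of sizes $n, n, d, c$, and the selection matrices are $P_\alpha = [\,I_{n}\;\; 0_{n\times n}\;\; 0_{n\times d}\;\; 0_{n\times c}\,]$, $P_\beta = [\,0_{n\times n}\;\; I_{n}\;\; 0_{n\times d}\;\; 0_{n\times c}\,]$, $P_u = [\,0_{d\times n}\;\; 0_{d\times n}\;\; I_{d}\;\; 0_{d\times c}\,]$, $P_v = [\,0_{c\times n}\;\; 0_{c\times n}\;\; 0_{c\times d}\;\; I_{c}\,]$, $P_{\alpha\beta} = \begin{bmatrix} P_\alpha \\ P_\beta\end{bmatrix} \in \mathbb{R}^{2n\times p}$, and $M = -P_\alpha + P_\beta + XP_u \in \mathbb{R}^{n\times p}$. *)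

(* Defs.v *)
From HB Require Import structures.
From mathcomp Require Import all_boot all_order all_algebra.
From mathcomp Require Import boolp classical_sets reals convex.

Set Implicit Arguments.
Unset Strict Implicit.
Unset Printing Implicit Defensive.

Import Order.TTheory GRing.Theory Num.Theory.

Local Open Scope classical_set_scope.
Local Open Scope ring_scope.

Definition convex_hull (R : realType) (V : lmodType R) (S : set V) : set V :=
  smallest (@convex_set R V) S.

Definition PSD {R : realType} {k : nat} : set 'M[R]_k :=
  convex_hull [set w *m w^T | w in [set: 'cV[R]_k]].

Definition CP {R : realType} {k : nat} : set 'M[R]_k :=
  convex_hull [set w *m w^T | w in [set w : 'cV[R]_k | forall i, 0 <= w i 0]].

(* Symmetry is not required. *)
Definition NN {R : realType} {k : nat} : set 'M[R]_k :=
  [set A | forall i j, 0 <= A i j].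

Definition DNN {R : realType} {k : nat} : set 'M[R]_k := PSD `&` NN.

Definition frobenius_norm (R : realType) (m n : nat) (A : 'M[R]_(m, n)) : R :=
  Num.sqrt (\sum_i \sum_j A i j ^+ 2).

(* The dimension p = 2n + d + c is written n + n + d + c, and 2n is written
   n + n, so that block matrices need no dimension casts. *)
Definition P_alpha {R : realType} {n d c : nat} : 'M[R]_(n, n + n + d + c) :=
  row_mx (row_mx (row_mx 1%:M 0) 0) 0.

Definition P_beta {R : realType} {n d c : nat} : 'M[R]_(n, n + n + d + c) :=
  row_mx (row_mx (row_mx 0 1%:M) 0) 0.

Definition P_u {R : realType} {n d c : nat} : 'M[R]_(d, n + n + d + c) :=
  row_mx (row_mx (row_mx 0 0) 1%:M) 0.

Definition P_v {R : realType} {n d c : nat} : 'M[R]_(c, n + n + d + c) :=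
  row_mx (row_mx (row_mx 0 0) 0) 1%:M.

Definition P_alphabeta {R : realType} {n d c : nat} :
    'M[R]_(n + n, n + n + d + c) :=
  col_mx P_alpha P_beta.

Definition data_mx {R : realType} {n d c : nat} (X : 'M[R]_(n, d)) :
    'M[R]_(n, n + n + d + c) :=
  - P_alpha + P_beta + X *m P_u.

Record min_problem (R : realType) (T : Type) := MinProblem {
  objective : T -> R;
  feasible : set T
}.

Definition relaxation (R : realType) (T : Type) (Q P : min_problem R T) : Prop :=
  objective Q = objective P /\ feasible P `<=` feasible Q.

Definition NN_objective (R : realType) (n d c : nat) (Y : 'M[R]_(n, c))
    (gamma : R) (L : 'M[R]_(n + n + d + c)) : R :=
  frobenius_norm (P_alpha *m L *m P_v^T - Y) ^+ 2
  + gamma / 2 * (\tr (P_u *m L *m P_u^T) + \tr (P_v *m L *m P_v^T)).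

(* [K] is the cone constraining the (alpha, beta) diagonal block of [L]:
   changing only this constraint amounts to changing [K]. *)
Definition NN_problem (R : realType) (n d c : nat) (X : 'M[R]_(n, d))
    (Y : 'M[R]_(n, c)) (gamma : R) (K : set 'M[R]_(n + n)) :
    min_problem R 'M[R]_(n + n + d + c) :=
  {| objective := NN_objective Y gamma;
     feasible := [set L | [/\
       \tr (P_alpha *m L *m P_beta^T)
         + \tr (data_mx X *m L *m (data_mx X)^T) = 0,
       PSD L &
       K (P_alphabeta *m L *m P_alphabeta^T)]] |}.

Definition CP_NN (R : realType) (n d c : nat) (X : 'M[R]_(n, d))
    (Y : 'M[R]_(n, c)) (gamma : R) : min_problem R 'M[R]_(n + n + d + c) :=
  NN_problem X Y gamma CP.

Definition SDP_NN (R : realType) (n d c : nat) (X : 'M[R]_(n, d))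
    (Y : 'M[R]_(n, c)) (gamma : R) : min_problem R 'M[R]_(n + n + d + c) :=
  NN_problem X Y gamma NN.

(* Main.v *)
Require Import Defs.
From mathcomp Require Import all_boot all_order all_algebra.
From mathcomp Require Import boolp classical_sets reals convex.
From mathcomp Require Import unstable interval_inference.

Import Order.TTheory GRing.Theory Num.Theory.

Local Open Scope classical_set_scope.
Local Open Scope ring_scope.

(** The two problems differ only in the cone [K]. The relaxation is the inclusion of [CP] in [NN]
    ([CP_sub_NN]). Replacing [NN] by [DNN] changes nothing because congruence by [P_alphabeta] keeps
    [L] in [PSD] ([PSD_congruence]). Since [CP] and [PSD] are convex hulls, each fact is checked on
    the generators [w *m w^T] only, once the target set is known to be convex. *)

Lemma convex_hull_convex {R : realType} {V : lmodType R} (S : set V) :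
  @convex_set R V (convex_hull S).
Proof.
move=> x y t /set_mem Sx /set_mem Sy; apply/mem_set => A [Acvx SA].
apply/set_mem/Acvx; apply/mem_set.
- by apply: Sx.
- by apply: Sy.
Qed.

Lemma convex_set_preimage {R : realType} {V W : lmodType R}
    (f : {linear V -> W}) (A : set W) :
  @convex_set R W A -> @convex_set R V (f @^-1` A).
Proof.
move=> Acvx x y t /set_mem fx /set_mem fy; apply/mem_set.
rewrite /= /conv /= linearD !linearZ.
by apply/set_mem/(Acvx (f x) (f y) t); apply/mem_set.
Qed.

(** Congruence by [P] is linear in [L], so the preimage of [PSD] under it is convex; it contains
    every generator, as [w *m w^T] is sent to the generator given by [P *m w]. *)
Lemma PSD_congruence {R : realType} {k m : nat} (P : 'M[R]_(m, k))
    (L : 'M[R]_k) :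
  PSD L -> PSD (P *m L *m P^T).
Proof.
apply: (@smallest_sub _ _ _ ((mulmxr P^T \o mulmx P) @^-1` PSD)).
  exact/convex_set_preimage/convex_hull_convex.
move=> _ [w _ <-] /=; apply: sub_gen_smallest; exists (P *m w) => //.
by rewrite trmx_mul !mulmxA.
Qed.

Lemma NN_convex {R : realType} {k : nat} : @convex_set R 'M[R]_k NN.
Proof.
move=> A B t /set_mem A0 /set_mem B0; apply/mem_set => i j.
by rewrite /conv /= !mxE addr_ge0 // mulr_ge0 // onem_ge0.
Qed.

(** [NN] is convex, and the entries of a generator are products of two non-negative coordinates of
    [w]. *)
Lemma CP_sub_NN {R : realType} {k : nat} : @CP R k `<=` NN.
Proof.
apply: smallest_sub; first exact: NN_convex.
move=> _ [w w0 <-] i j; rewrite mxE big_ord1 mxE.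
exact: mulr_ge0.
Qed.

Theorem proposition1 (R : realType) (d c n : nat)
    (d_gt0 : (0 < d)%N) (c_gt0 : (0 < c)%N) (n_gt0 : (0 < n)%N)
    (X : 'M[R]_(n, d)) (Y : 'M[R]_(n, c)) (gamma : R) (gamma_ge0 : 0 <= gamma) :
  [/\ relaxation (SDP_NN X Y gamma) (CP_NN X Y gamma),
      SDP_NN X Y gamma = NN_problem X Y gamma DNN &
      forall L : 'M[R]_(n + n + d + c),
        PSD L -> PSD (P_alphabeta *m L *m P_alphabeta^T)].
Proof.
split; last by move=> L; exact: PSD_congruence.
- by split=> // L [trL psdL /CP_sub_NN].
- rewrite /SDP_NN /NN_problem; congr MinProblem.
  apply/seteqP; split=> L /= [trL psdL].
  (* The [PSD] half of [DNN] is inherited from [psdL]. *)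
  + by split=> //; split=> //; exact: PSD_congruence.
  + by case.
Qed.
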